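(* Let $A\in\mathbb{R}^{n\times n}$, $E\in\mathbb{R}^{n\times m}$, $\mathcal{X}\subset\mathbb{R}^n$, $\mathcal{D}^\ast\subset\mathbb{R}^m$ and $\alpha\in\mathbb{R}_+$ satisfy the assumptions listed in the context. Then, for every $\epsilon\in\mathbb{R}_+$, there exists a $\delta\in\mathbb{R}_+$ such that $$\mathcal{C}_{\max}^\alpha\subseteq\mathcal{C}_{\max}^{\alpha+\delta}\subseteq(1+\epsilon)\,\mathcal{C}_{\max}^\alpha.$$
   Context: Notation: $\mathbb{R}_+$ is the set of positive reals, $\mathbb{N}_{[i,k]}=\{j\in\mathbb{N}\mid i\le j\le k\}$. A C-set is a convex and compact set containing the origin as an interior point. $\beta\,\mathcal{U}=\{\beta u\mid u\in\mathcal{U}\}$. Assumptions: there is $r\in\mathbb{N}_{[1,n]}$ such that $$A=\begin{pmatrix}A_{11}&A_{12}\\0&A_{22}\end{pmatrix},\qquad E=\begin{pmatrix}E_1\\0\end{pmatrix}$$ with $A_{11}\in\mathbb{R}^{r\times r}$, $A_{12}\in\mathbb{R}^{r\times(n-r)}$, $A_{22}\in\mathbb{R}^{(n-r)\times(n-r)}$, $E_1\in\mathbb{R}^{r\times m}$; the pair $(A_{11},E_1)$ is controllable; $\mathcal{X}\subset\mathbb{R}^n$ and $\mathcal{D}^\ast\subset\mathbb{R}^m$ are C-sets; $\alpha\in\mathbb{R}_+$; all eigenvalues $\lambda\in\mathbb{C}$ of $A_{22}$ satisfy $|\lambda|\leq1$ (no stability of $A_{11}$ is required). The system is $x(k+1)=A\,x(k)+E\,d(k)$,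 where $d(k)$ is a control input, with constraints $x(k)\in\mathcal{X}$ and $d(k)\in\mathcal{D}^\alpha:=\alpha\,\mathcal{D}^\ast$. A set $\mathcal{C}\subseteq\mathbb{R}^n$ is controlled invariant (CI) for scaling $\alpha$ if $\mathcal{C}\subseteq\mathcal{X}$ and for every $x\in\mathcal{C}$ there exists a $d\in\mathcal{D}^\alpha$ such that $Ax+Ed\in\mathcal{C}$. The maximal controlled invariant set $\mathcal{C}_{\max}^\alpha$ is the union of all CI sets for scaling $\alpha$. *)

(* Defs.v *)
From HB Require Import structures.
From mathcomp Require Import all_boot all_order all_algebra.
From mathcomp Require Import complex.
From mathcomp Require Import all_classical all_reals all_analysis.

Set Implicit Arguments.
Unset Strict Implicit.
Unset Printing Implicit Defensive.

Import Order.TTheory GRing.Theory Num.Theory.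
Import numFieldNormedType.Exports.

Local Open Scope classical_set_scope.
Local Open Scope ring_scope.

Definition C_set (R : realType) (n : nat) (S : set 'cV[R]_n) : Prop :=
  [/\ convex_set S, compact S & S° 0].

Definition scale_set (R : realType) (n : nat) (beta : R) (U : set 'cV[R]_n) :
  set 'cV[R]_n := [set beta *: u | u in U].

Definition next_state (R : realType) (n m : nat) (A : 'M[R]_n)
  (E : 'M[R]_(n, m)) (x : 'cV[R]_n) (d : 'cV[R]_m) : 'cV[R]_n :=
  A *m x + E *m d.

Fixpoint trajectory (R : realType) (n m : nat) (A : 'M[R]_n)
  (E : 'M[R]_(n, m)) (x0 : 'cV[R]_n) (d : nat -> 'cV[R]_m) (k : nat) :
  'cV[R]_n :=
  if k is j.+1 then next_state A E (trajectory A E x0 d j) (d j) else x0.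

(* Transfer between arbitrary states, which for a discrete-time system is the
   Kalman rank condition; steering every state to the origin would be strictly
   weaker when [A] is singular. *)
Definition controllable (R : realType) (n m : nat) (A : 'M[R]_n)
  (E : 'M[R]_(n, m)) : Prop :=
  forall x0 x1 : 'cV[R]_n, exists (N : nat) (d : nat -> 'cV[R]_m),
    trajectory A E x0 d N = x1.

Definition complex_eigenvalue (R : realType) (n : nat) (A : 'M[R]_n)
  (lambda : R[i]) : bool := eigenvalue (map_mx (real_complex R) A) lambda.

Definition controlled_invariant (R : realType) (n m : nat) (A : 'M[R]_n)
  (E : 'M[R]_(n, m)) (X : set 'cV[R]_n) (Dstar : set 'cV[R]_m) (alpha : R)
  (C : set 'cV[R]_n) : Prop :=
  C `<=` X /\
  forall x, C x ->
    exists d, scale_set alpha Dstar d /\ C (next_state A E x d).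

Definition C_max (R : realType) (n m : nat) (A : 'M[R]_n)
  (E : 'M[R]_(n, m)) (X : set 'cV[R]_n) (Dstar : set 'cV[R]_m) (alpha : R) :
  set 'cV[R]_n :=
  \bigcup_(C in [set C | controlled_invariant A E X Dstar alpha C]) C.

(* Main.v *)
(* Shrinking by the factor [1 + eps] a controlled invariant set for scaling
   [(1 + eps) * alpha] gives, by linearity of the dynamics, one for scaling
   [alpha], so [delta := eps * alpha] works. *)
Require Import Defs.
From HB Require Import structures.
From mathcomp Require Import all_boot all_order all_algebra.
From mathcomp Require Import complex.
From mathcomp Require Import all_classical all_reals all_analysis.

Set Implicit Arguments.
Unset Strict Implicit.
Unset Printing Implicit Defensive.

Import Order.TTheory GRing.Theory Num.Theory.
Import numFieldNormedType.Exports.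

Local Open Scope classical_set_scope.
Local Open Scope ring_scope.

(** The dynamics are jointly homogeneous in state and input ([next_stateZ]), and a C-set is
    star-shaped about the origin ([C_set_shrink]). Star-shapedness of [Dstar] makes the admissible
    inputs, hence [C_max], grow with the scaling: this is the first inclusion. Homogeneity and
    star-shapedness of [X] let a controlled invariant set and its scaling shrink together, so
    [C_max_scale] bounds the maximal set for [(1 + eps) * alpha] by [1 + eps] times the one for
    [alpha]. *)

Lemma C_set_shrink (R : realType) (n : nat) (S : set 'cV[R]_n) (t : R)
    (x : 'cV[R]_n) :
  C_set S -> 0 <= t -> t <= 1 -> S x -> S (t *: x).
Proof.
move=> [cS _ S0] t0 t1 Sx.
(* The point [t *: x] is the convex combination of [x] and the interior point [0] with weights [t]
   and [1 - t]. *)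
have := cS x 0 (Itv01 t0 t1) (mem_set Sx) (mem_set (nbhs_singleton S0)).
by move=> /set_mem; rewrite /conv /= scaler0 addr0.
Qed.

Lemma scale_set_homo (R : realType) (n : nat) (S : set 'cV[R]_n) (a b : R) :
  C_set S -> 0 <= a -> a <= b -> scale_set a S `<=` scale_set b S.
Proof.
move=> CS a0 ab _ [u Su <-].
(* If [b <= 0], then [a = b = 0] and [u] itself serves; otherwise [a / b] is a shrinking factor in
   [0, 1]. *)
have [b0|b_gt0] := leP b 0.
  by exists u => //; have -> : b = a by apply/eqP; rewrite eq_le ab (le_trans b0).
exists ((a / b) *: u).
  by apply: C_set_shrink => //; rewrite ?ler_pdivrMr ?mul1r ?divr_ge0 // ltW.
by rewrite scalerA mulrC divfK ?gt_eqF.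
Qed.

Lemma C_max_homo (R : realType) (n m : nat) (A : 'M[R]_n) (E : 'M[R]_(n, m))
    (X : set 'cV[R]_n) (D : set 'cV[R]_m) (a b : R) :
  C_set D -> 0 <= a -> a <= b -> C_max A E X D a `<=` C_max A E X D b.
Proof.
move=> CD a0 ab x [C [CX CI] Cx]; exists C => //; split=> // y /CI [d [Dd Cd]].
by exists d; split=> //; apply: scale_set_homo Dd.
Qed.

Lemma next_stateZ (R : realType) (n m : nat) (A : 'M[R]_n) (E : 'M[R]_(n, m))
    (t : R) (x : 'cV[R]_n) (d : 'cV[R]_m) :
  next_state A E (t *: x) (t *: d) = t *: next_state A E x d.
Proof. by rewrite /next_state -!scalemxAr scalerDr. Qed.

(** If [a *: u] keeps [x] in [C], then [(t * a) *: u], with the same [u] in [D], keeps [t *: x] in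
    the shrunk set. *)
Lemma controlled_invariant_shrink (R : realType) (n m : nat) (A : 'M[R]_n)
    (E : 'M[R]_(n, m)) (X : set 'cV[R]_n) (D : set 'cV[R]_m) (a t : R)
    (C : set 'cV[R]_n) :
  C_set X -> 0 <= t -> t <= 1 ->
  controlled_invariant A E X D a C ->
  controlled_invariant A E X D (t * a) (scale_set t C).
Proof.
move=> CX t0 t1 [subX CI]; split=> [_ [x Cx <-]|_ [x Cx <-]].
  by apply: C_set_shrink => //; apply: subX.
have [_ [[u Du <-] Cd]] := CI x Cx.
exists (t *: (a *: u)); split; first by exists u; rewrite ?scalerA.
by rewrite next_stateZ; exists (next_state A E x (a *: u)).
Qed.

Lemma C_max_scale (R : realType) (n m : nat) (A : 'M[R]_n) (E : 'M[R]_(n, m))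
    (X : set 'cV[R]_n) (D : set 'cV[R]_m) (a b : R) :
  C_set X -> 1 <= b -> C_max A E X D (b * a) `<=` scale_set b (C_max A E X D a).
Proof.
move=> CX b1 x [C CI Cx]; have b0 : 0 < b := lt_le_trans ltr01 b1.
exists (b^-1 *: x); last by rewrite scalerA divff ?gt_eqF // scale1r.
exists (scale_set b^-1 C); last by exists x.
(* Writing [a] as [b^-1 * (b * a)] exhibits it as the scaling [b * a] of [C] shrunk by [b^-1]. *)
rewrite /= -[a](mulKf (lt0r_neq0 b0)).
by apply: controlled_invariant_shrink; rewrite ?invr_ge0 ?invf_le1 // ltW.
Qed.

Theorem theorem9 (R : realType) (n m r : nat)
  (A : 'M[R]_n) (E : 'M[R]_(n, m))
  (X : set 'cV[R]_n) (Dstar : set 'cV[R]_m) (alpha : R)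
  (r_gt0 : (1 <= r)%N) (r_le_n : (r <= n)%N)
  (A11 : 'M[R]_r) (A12 : 'M[R]_(r, n - r)) (A22 : 'M[R]_(n - r))
  (E1 : 'M[R]_(r, m))
  (A_block : A = castmx (subnKC r_le_n, subnKC r_le_n)
                   (block_mx A11 A12 0 A22))
  (E_block : E = castmx (subnKC r_le_n, erefl m) (col_mx E1 0))
  (A11_E1_controllable : controllable A11 E1)
  (X_C_set : C_set X) (Dstar_C_set : C_set Dstar)
  (alpha_gt0 : 0 < alpha)
  (A22_eigenvalues : forall lambda : R[i],
     complex_eigenvalue A22 lambda -> `|lambda| <= 1) :
  forall eps : R, 0 < eps ->
  exists delta : R, 0 < delta /\
    C_max A E X Dstar alpha `<=` C_max A E X Dstar (alpha + delta) /\
    C_max A E X Dstar (alpha + delta)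
      `<=` scale_set (1 + eps) (C_max A E X Dstar alpha).
Proof.
move=> eps eps_gt0; have delta_gt0 : 0 < eps * alpha by rewrite mulr_gt0.
exists (eps * alpha); split=> //; split.
  by apply: C_max_homo; rewrite ?lerDl // ltW.
rewrite (_ : alpha + eps * alpha = (1 + eps) * alpha); last first.
  by rewrite mulrDl mul1r.
by apply: C_max_scale; rewrite // lerDl ltW.
Qed.
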